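(* Let $(T(t))_{t\ge0}$ be a bounded $C_0$-semigroup on a complex Banach space $X$ with generator $-A$. Let $\varphi$ be a positive, increasing function on $[1,\infty)$ such that $$\int_1^\infty\frac{dt}{t\varphi(t)}=\infty.$$ If $x\in X$ satisfies $$\int_1^\infty\frac{\|C_t(A)x\|}{\varphi(t)}\,dt<\infty,$$ then $x=0$. In particular, if $$\int_1^\infty\frac{\|C_t(A)x\|}{\log(1+t)}\,dt<\infty,$$ then $x=0$.
   Context: $C_t(A)x:=\frac1t\int_0^tT(s)x\,ds$ for $t>0$, $x\in X$ (Cesàro means). *)

(* Defs.v *)
From Stdlib Require Import Reals.
From Coquelicot Require Import Coquelicot.
Open Scope R_scope.

(** Coquelicot integrates functions with values in modules over [R], so a
    complex Banach space is also viewed, with the same carrier, addition, norm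
    and uniform structure, as a real one. *)
Section RestrictScalars.

Variable X : CompleteNormedModule C_AbsRing.

Definition real_scal (r : R) (x : X) : X := scal (RtoC r) x.

Lemma real_scal_assoc (r s : R) (x : X) :
  real_scal r (real_scal s x) = real_scal (mult r s) x.
Proof.
unfold real_scal; rewrite scal_assoc; f_equal.
symmetry; exact (RtoC_mult r s).
Qed.

Lemma real_scal_one (x : X) : real_scal one x = x.
Proof. exact (scal_one x). Qed.

Lemma real_scal_distr_l (r : R) (x y : X) :
  real_scal r (plus x y) = plus (real_scal r x) (real_scal r y).
Proof. exact (scal_distr_l (RtoC r) x y). Qed.

Lemma real_scal_distr_r (r s : R) (x : X) :
  real_scal (plus r s) x = plus (real_scal r x) (real_scal s x).
Proof.
unfold real_scal.
replace (RtoC (plus r s)) with (plus (RtoC r) (RtoC s))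
  by (symmetry; exact (RtoC_plus r s)).
exact (scal_distr_r (RtoC r) (RtoC s) x).
Qed.

Lemma norm_real_scal (r : R) (x : X) :
  norm (real_scal r x) <= abs r * norm x.
Proof.
replace (abs r) with (abs (RtoC r)) by exact (Cmod_R r).
exact (norm_scal (RtoC r) x).
Qed.

Definition realify_ModuleSpace_class : ModuleSpace.class_of R_Ring X :=
  ModuleSpace.Class R_Ring X
    (AbelianGroup.class X)
    (ModuleSpace.Mixin R_Ring X real_scal real_scal_assoc real_scal_one
       real_scal_distr_l real_scal_distr_r).

Definition realify_NormedModuleAux : NormedModuleAux R_AbsRing :=
  NormedModuleAux.Pack R_AbsRing X
    (NormedModuleAux.Class R_AbsRing X realify_ModuleSpace_class
       (UniformSpace.class X)) X.

Definition realify_NormedModule_class : NormedModule.class_of R_AbsRing X :=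
  NormedModule.Class R_AbsRing X
    (NormedModuleAux.class R_AbsRing realify_NormedModuleAux)
    (NormedModule.Mixin R_AbsRing realify_NormedModuleAux
       (@norm C_AbsRing X) (@norm_factor C_AbsRing X)
       norm_triangle norm_real_scal norm_compat1 norm_compat2 norm_eq_zero).

Definition realify : CompleteNormedModule R_AbsRing :=
  CompleteNormedModule.Pack R_AbsRing X
    (CompleteNormedModule.Class R_AbsRing X realify_NormedModule_class
       (CompleteNormedModule.mixin C_AbsRing X
          (CompleteNormedModule.class C_AbsRing X))) X.

End RestrictScalars.

(** Only the values [T t] with [0 <= t] are meaningful. *)
Record C0_semigroup {X : CompleteNormedModule C_AbsRing} (T : R -> X -> X)
  : Prop := {
  C0_bounded_linear : forall t, 0 <= t -> is_linear (T t);
  C0_zero : forall x, T 0 x = x;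
  C0_plus : forall s t x, 0 <= s -> 0 <= t -> T (s + t) x = T s (T t x);
  C0_continuous :
    forall x, filterlim (fun t => T t x) (at_right 0) (locally x)
}.

Definition bounded_semigroup {X : CompleteNormedModule C_AbsRing}
  (T : R -> X -> X) : Prop :=
  exists M : R, forall t x, 0 <= t -> norm (T t x) <= M * norm x.

(** An unbounded operator is represented by its graph: [B x y] means that [x]
    is in the domain of [B] and [B x = y]. *)
Definition is_generator {X : CompleteNormedModule C_AbsRing}
  (T : R -> X -> X) (B : X -> X -> Prop) : Prop :=
  forall x y,
    B x y <->
    filterlim (fun t => scal (RtoC (/ t)) (minus (T t x) x))
      (at_right 0) (locally y).

Definition opp_operator {X : CompleteNormedModule C_AbsRing}
  (A : X -> X -> Prop) : X -> X -> Prop :=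
  fun x y => A x (opp y).

(** The mean [C_t(A) x], where [- A] generates [T]. The integrand is continuous
    on [[0, t]], so the Riemann integral is the Bochner integral. *)
Definition cesaro {X : CompleteNormedModule C_AbsRing}
  (T : R -> X -> X) (t : R) (x : X) : X :=
  scal (RtoC (/ t)) (RInt (V := realify X) (fun s => T s x) 0 t).

(** Improper integrals over [[a, +oo)] as limits of proper ones. For a
    nonnegative [f], [integral_finite f a] says that the integral is finite;
    [integral_infinite f a] is [is_RInt_gen] with the limit [p_infty]. *)
Definition integral_finite (f : R -> R) (a : R) : Prop :=
  ex_RInt_gen f (at_point a) (Rbar_locally p_infty).

Definition integral_infinite (f : R -> R) (a : R) : Prop :=
  filterlimi (fun ab : R * R => is_RInt f (fst ab) (snd ab))
    (filter_prod (at_point a) (Rbar_locally p_infty)) (Rbar_locally p_infty).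

(* Main.v *)
Require Import Defs.
From Stdlib Require Import Reals Lra.
From Coquelicot Require Import Coquelicot.
Open Scope R_scope.

(** Put [y t = t C_t x], the integral of the orbit of [x] over [[0, t]], and
    [w t = 1 / (t phi t)]. Since [y (t + s) = y s + T s (y t)], we have
    [|y s| <= |y (t + s)| + M |y t|] for all [t], where [M] bounds the semigroup.
    Multiply by [w (t + s)], which is at most [w t], and integrate over [t]: the
    right-hand side stays bounded because [|y| w = |C_t x| / phi] is integrable,
    while the integral of [w (t + s)] diverges. Hence [y s = 0] for all [s > 0],
    and [x], the limit of [y s / s] at [0], vanishes. *)

(** * Riemann integrals under linear maps and translations *)

(** A linear map commutes with every Riemann sum, and its continuity passes this on to the limit. *)
Lemma is_RInt_linear {U V : NormedModule R_AbsRing} (l : U -> V) (f : R -> U)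
  (a b : R) (If : U) :
  is_linear l -> is_RInt f a b If -> is_RInt (fun t => l (f t)) a b (l If).
Proof.
intros Hl Hf.
apply (filterlim_ext
  (fun ptd => l (scal (sign (b - a)) (Riemann_sum f ptd)))).
- intros ptd.
  rewrite (linear_scal l Hl); f_equal.
  induction ptd as [x0 | h ptd IH] using SF_cons_ind.
  + exact (linear_zero l Hl).
  + rewrite !Riemann_sum_cons, (linear_plus l Hl), (linear_scal l Hl), IH.
    reflexivity.
- exact (filterlim_comp _ _ _ _ l _ _ _ Hf (linear_cont l If Hl)).
Qed.

(** [norm_scal] bounds from above; applied to [/ r] and [scal r v] it yields this reverse
    estimate. *)
Lemma norm_le_scal {V : NormedModule R_AbsRing} (r : R) (v : V) :
  0 < r -> r * norm v <= norm (scal r v).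
Proof.
intros Hr.
assert (Hv : norm v <= / r * norm (scal r v)).
{ rewrite <- (Rabs_pos_eq (/ r)) by (left; now apply Rinv_0_lt_compat).
  replace v with (scal (/ r) (scal r v)) at 1.
  - exact (norm_scal (/ r) (scal r v)).
  - rewrite scal_assoc.
    replace (mult (/ r) r) with (@one R_Ring).
    + apply scal_one.
    + symmetry; apply Rinv_l; lra. }
apply (Rmult_le_compat_l r) in Hv; [|lra].
rewrite <- Rmult_assoc, Rinv_r, Rmult_1_l in Hv; lra.
Qed.

Lemma is_RInt_shift {V : NormedModule R_AbsRing} (f : R -> V) (v a b : R)
  (If : V) :
  is_RInt f (a + v) (b + v) If -> is_RInt (fun t => f (t + v)) a b If.
Proof.
intros Hf.
apply (is_RInt_ext (fun t => scal 1 (f (1 * t + v)))).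
- intros t _; rewrite Rmult_1_l; exact (scal_one (f (t + v))).
- apply is_RInt_comp_lin; rewrite !Rmult_1_l; exact Hf.
Qed.

(** * Improper integrals and the comparison with a shifted weight *)

Lemma integral_finite_bounded (f : R -> R) (a : R) :
  integral_finite f a ->
  exists C b0, forall b, b0 < b -> exists I, is_RInt f a b I /\ I <= C.
Proof.
intros [l Hl].
assert (Hloc : locally l (fun y : R => y <= l + 1)).
{ exists (mkposreal 1 Rlt_0_1); intros y Hy.
  assert (Hy' : Rabs (y - l) < 1) by exact Hy.
  apply Rabs_def2 in Hy'; lra. }
destruct (Hl _ Hloc) as [Q P HQ [b0 HP] H].
exists (l + 1), b0; intros b Hb.
exact (H a b HQ (HP b Hb)).
Qed.

Lemma integral_infinite_unbounded (f : R -> R) (a : R) :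
  integral_infinite f a ->
  forall C, exists b0, forall b, b0 < b -> exists I, is_RInt f a b I /\ C < I.
Proof.
intros Hf C.
assert (Hloc : Rbar_locally p_infty (fun y : R => C < y))
  by (exists C; now intros y).
destruct (Hf _ Hloc) as [Q P HQ [b0 HP] H].
exists b0; intros b Hb.
exact (H a b HQ (HP b Hb)).
Qed.

(** The scalar core, used with [c] the norm of [y s]. Integrating the inequality over [[1, b - s]]
    bounds [c] times the integral of [w] over [[1 + s, b]] by [(1 + K) * C], uniformly in large [b];
    divergence of the integral of [w] then rules out [c > 0]. *)
Lemma shifted_bound_nonpos (w g : R -> R) (c K s : R) :
  integral_infinite w 1 -> integral_finite g 1 ->
  0 <= K -> 0 < s -> (forall t, 1 <= t -> 0 <= g t) ->
  (forall t, 1 <= t -> c * w (t + s) <= g (t + s) + K * g t) ->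
  c <= 0.
Proof.
intros Hw Hg HK Hs Hg0 Hle.
destruct (Rle_or_lt c 0) as [Hc | Hc]; [exact Hc | exfalso].
destruct (integral_finite_bounded _ _ Hg) as (C & b1 & Hb1).
pose (I0 := RInt w 1 (1 + s)).
(* With the initial piece [I0] removed, the integral of [w] over [[1 + s, b]] still exceeds
   [(1 + K) * C / c]. *)
destruct (integral_infinite_unbounded _ _ Hw (I0 + (1 + K) * C / c))
  as [b2 Hb2].
(* Both [b] and [b - s] must pass [b1], since [g] is integrated up to each of them. *)
set (b := Rmax (1 + s) (Rmax b1 b2) + s + 1).
assert (Hb : 1 + s <= b - s /\ b1 < b - s /\ b2 < b).
{ generalize (Rmax_l (1 + s) (Rmax b1 b2)) (Rmax_r (1 + s) (Rmax b1 b2))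
    (Rmax_l b1 b2) (Rmax_r b1 b2); unfold b; lra. }
clearbody b.
destruct (Hb1 b) as (G & HG & HGC); [lra|].
destruct (Hb1 (b - s)) as (G' & HG' & HGC'); [lra|].
destruct (Hb2 b) as (W & HW & HWC); [lra|].
assert (HexW1 : ex_RInt w 1 (1 + s))
  by (apply (ex_RInt_Chasles_1 (V := R_CompleteNormedModule)) with b;
      [lra | now exists W]).
assert (HexW2 : ex_RInt w (1 + s) b)
  by (apply (ex_RInt_Chasles_2 (V := R_CompleteNormedModule)) with 1;
      [lra | now exists W]).
assert (HexG1 : ex_RInt g 1 (1 + s))
  by (apply (ex_RInt_Chasles_1 (V := R_CompleteNormedModule)) with b;
      [lra | now exists G]).
assert (HexG2 : ex_RInt g (1 + s) b)
  by (apply (ex_RInt_Chasles_2 (V := R_CompleteNormedModule)) with 1;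
      [lra | now exists G]).
apply (RInt_correct (V := R_CompleteNormedModule)) in HexW1, HexW2, HexG1, HexG2.
fold I0 in HexW1.
assert (HWsum : W = I0 + RInt w (1 + s) b).
{ rewrite <- (is_RInt_unique _ _ _ _ HW).
  apply is_RInt_unique; exact (is_RInt_Chasles _ _ _ _ _ _ HexW1 HexW2). }
assert (HGsum : G = RInt g 1 (1 + s) + RInt g (1 + s) b).
{ rewrite <- (is_RInt_unique _ _ _ _ HG).
  apply is_RInt_unique; exact (is_RInt_Chasles _ _ _ _ _ _ HexG1 HexG2). }
(* Nonnegativity of [g] allows the piece over [[1, 1 + s]] to be dropped, so the integral over
   [[1 + s, b]] is also at most [C]. *)
assert (HG1 : 0 <= RInt g 1 (1 + s)).
{ apply (is_RInt_ge_0 g 1 (1 + s)); [lra | exact HexG1 |].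
  intros t Ht; apply Hg0; lra. }
assert (Hint : c * RInt w (1 + s) b <= RInt g (1 + s) b + K * G').
{ apply (is_RInt_le (fun t => c * w (t + s)) (fun t => g (t + s) + K * g t)
    1 (b - s)).
  - lra.
  - apply (is_RInt_scal (V := R_NormedModule)
      (fun t => w (t + s)) 1 (b - s) c), is_RInt_shift.
    replace (b - s + s) with b by ring; exact HexW2.
  - apply (is_RInt_plus (V := R_NormedModule)
      (fun t => g (t + s)) (fun t => K * g t)).
    + apply is_RInt_shift.
      replace (b - s + s) with b by ring; exact HexG2.
    + exact (is_RInt_scal (V := R_NormedModule) g 1 (b - s) K _ HG').
  - intros t Ht; apply Hle; lra. }
assert (HKG : K * G' <= K * C) by (apply Rmult_le_compat_l; lra).
assert (Hlow : (1 + K) * C / c < RInt w (1 + s) b) by lra.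
apply (Rmult_lt_compat_l c) in Hlow; [|exact Hc].
replace (c * ((1 + K) * C / c)) with ((1 + K) * C) in Hlow by (field; lra).
lra.
Qed.

(** * Orbits of the semigroup and their integrals *)

Section Orbits.

Context {X : CompleteNormedModule C_AbsRing} (T : R -> X -> X).
Hypothesis HT : C0_semigroup T.
Variable M : R.
Hypothesis HM : forall t x, 0 <= t -> norm (T t x) <= M * norm x.

Let XR := realify X.

(** The [y t] of the overview: without the factor [1 / t], the semigroup law becomes an exact
    addition formula. *)
Definition orbit_integral (x : X) (t : R) : X :=
  RInt (V := realify X) (fun s => T s x) 0 t.

Lemma real_linear (t : R) : 0 <= t -> is_linear (U := XR) (V := XR) (T t).
Proof.
intros Ht; destruct (C0_bounded_linear T HT t Ht) as [Hp Hs Hn].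
split; [exact Hp | intros k x; exact (Hs (RtoC k) x) | exact Hn].
Qed.

Lemma C0_minus (t : R) (x y : X) :
  0 <= t -> T t (minus x y) = minus (T t x) (T t y).
Proof.
intros Ht; unfold minus.
rewrite (linear_plus _ (real_linear t Ht)).
f_equal; exact (linear_opp (U := XR) (V := XR) _ y (real_linear t Ht)).
Qed.

Lemma orbit_near_zero (x : X) (eps : R) :
  0 < eps ->
  exists d, 0 < d /\
    forall t, 0 <= t -> t < d -> norm (minus (T t x) x) < eps.
Proof.
intros He.
destruct (proj1 (filterlim_locally_ball_norm _ _) (C0_continuous T HT x)
  (mkposreal eps He)) as [d Hd].
exists d; split; [apply cond_pos|].
intros t [Ht | <-] Htd.
- apply Hd; [|exact Ht].
  change (Rabs (t - 0) < d); rewrite Rminus_0_r, Rabs_pos_eq; lra.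
(* The limit along [at_right 0] says nothing at [t = 0] itself. *)
- rewrite (C0_zero T HT), minus_eq_zero.
  eapply Rle_lt_trans; [right; exact (@norm_zero C_AbsRing X) | exact He].
Qed.

(** Factoring out [T] at the smaller time reduces continuity anywhere to continuity at 0. [Rabs M]
    appears because the sign of [M] is not given. *)
Lemma orbit_increment (x : X) (s t : R) :
  0 <= s -> 0 <= t ->
  norm (minus (T t x) (T s x)) <= Rabs M * norm (minus (T (Rabs (t - s)) x) x).
Proof.
assert (Hle : forall a b, 0 <= a -> a <= b ->
  norm (minus (T b x) (T a x)) <= Rabs M * norm (minus (T (b - a) x) x)).
{ intros a b Ha Hab.
  replace (T b x) with (T a (T (b - a) x)).
  - rewrite <- C0_minus by exact Ha.
    eapply Rle_trans; [apply HM, Ha|].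
    apply Rmult_le_compat_r; [apply norm_ge_0 | apply Rle_abs].
  - rewrite <- (C0_plus T HT) by lra; f_equal; ring. }
intros Hs Ht.
destruct (Rle_or_lt s t) as [Hst | Hst].
- rewrite (Rabs_pos_eq (t - s)) by lra; now apply Hle.
- rewrite (Rabs_left (t - s)), Ropp_minus_distr by lra.
  rewrite <- opp_minus, (norm_opp (V := X)); apply Hle; lra.
Qed.

(* [T] is arbitrary at negative times, hence the extension by [Rabs]. *)
Lemma orbit_continuous (x : X) (t : R) :
  0 <= t -> continuous (U := XR) (fun s => T (Rabs s) x) t.
Proof.
intros Ht.
apply (filterlim_locally_ball_norm (U := XR)); intros eps.
(* The added 1 keeps the denominator positive even when [M = 0]. *)
assert (He : 0 < eps / (Rabs M + 1)).
{ apply Rdiv_lt_0_compat; [apply cond_pos|].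
  generalize (Rabs_pos M); lra. }
destruct (orbit_near_zero x _ He) as (d & Hd & Hnear).
exists (mkposreal d Hd); intros s Hs.
assert (Hs' : Rabs (s - t) < d) by exact Hs.
rewrite (Rabs_pos_eq t) by exact Ht.
change (norm (minus (T (Rabs s) x) (T t x)) < eps).
eapply Rle_lt_trans; [apply orbit_increment; [exact Ht | apply Rabs_pos]|].
assert (Hd' : Rabs (Rabs s - t) < d).
{ rewrite <- (Rabs_pos_eq t) by exact Ht.
  eapply Rle_lt_trans; [apply Rabs_triang_inv2 | exact Hs']. }
specialize (Hnear _ (Rabs_pos _) Hd').
apply (Rmult_lt_compat_l (Rabs M + 1)) in Hnear;
  [|generalize (Rabs_pos M); lra].
replace ((Rabs M + 1) * (eps / (Rabs M + 1))) with (pos eps) in Hnear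
  by (field; generalize (Rabs_pos M); lra).
generalize (norm_ge_0 (minus (T (Rabs (Rabs s - t)) x) x)); lra.
Qed.

(** [RInt] is total, so [orbit_integral] is a genuine integral only once integrability is known; it
    comes from the continuous extension, which agrees with the orbit on [[0, t]]. *)
Lemma is_RInt_orbit (x : X) (t : R) :
  0 <= t ->
  is_RInt (V := XR) (fun s => T s x) 0 t (orbit_integral x t).
Proof.
intros Ht.
apply (RInt_correct (V := XR)).
apply (ex_RInt_ext (V := XR) (fun s => T (Rabs s) x)).
- rewrite Rmin_left, Rmax_right by exact Ht.
  intros s Hs; rewrite Rabs_pos_eq by lra; reflexivity.
- apply (ex_RInt_continuous (V := XR)).
  rewrite Rmin_left, Rmax_right by exact Ht.
  intros s Hs; apply orbit_continuous; lra.
Qed.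

(** Split at [s]; on [[s, t + s]] the integrand is [T s (T (u - s) x)], and [T s] comes out of the
    integral. *)
Lemma orbit_integral_plus (x : X) (s t : R) :
  0 <= s -> 0 <= t ->
  orbit_integral x (t + s) =
    plus (orbit_integral x s) (T s (orbit_integral x t)).
Proof.
intros Hs Ht.
apply (is_RInt_unique (V := XR)).
apply (is_RInt_Chasles (V := XR) _ 0 s); [now apply is_RInt_orbit|].
apply (is_RInt_ext (V := XR) (fun u => T s (T (u + - s) x))).
- rewrite Rmin_left, Rmax_right by lra.
  intros u Hu; rewrite <- (C0_plus T HT) by lra; f_equal; ring.
- apply (is_RInt_shift (V := XR) (fun u => T s (T u x))).
  replace (s + - s) with 0 by ring.
  replace (t + s + - s) with t by ring.
  apply (is_RInt_linear (U := XR) (V := XR));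
    [now apply real_linear | now apply is_RInt_orbit].
Qed.

Lemma norm_orbit_integral_le (x : X) (s t : R) :
  0 <= s -> 0 <= t ->
  norm (orbit_integral x s) <=
    norm (orbit_integral x (t + s)) + Rabs M * norm (orbit_integral x t).
Proof.
intros Hs Ht.
replace (orbit_integral x s)
  with (minus (orbit_integral x (t + s)) (T s (orbit_integral x t))).
- eapply Rle_trans; [exact (norm_triangle (V := X) _ (opp _))|].
  rewrite (norm_opp (V := X)); apply Rplus_le_compat_l.
  eapply Rle_trans; [apply HM, Hs|].
  apply Rmult_le_compat_r; [apply norm_ge_0 | apply Rle_abs].
- rewrite orbit_integral_plus by assumption.
  unfold minus; rewrite <- (plus_assoc (G := X)), (plus_opp_r (G := X)).
  exact (plus_zero_r (G := X) _).
Qed.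

(** If the orbit integrates to zero over [[0, t]], then [T s x - x] integrates to [- t x]. For small
    [t] that integral has norm at most [t * eps], so [norm x <= eps]. *)
Lemma orbit_integral_zero (x : X) :
  (forall s, 0 < s -> orbit_integral x s = zero) -> x = zero.
Proof.
intros H0.
apply (norm_eq_zero x).
apply Rle_antisym; [|apply norm_ge_0].
apply le_epsilon; intros eps He.
destruct (orbit_near_zero x eps He) as (d & Hd & Hnear).
set (t := d / 2).
assert (Ht : 0 < t < d) by (unfold t; lra).
assert (Hdiff : is_RInt (V := XR) (fun s => minus (T s x) x) 0 t
  (minus (zero : XR) (scal (t - 0) (x : XR)))).
{ apply (is_RInt_minus (V := XR)).
  - assert (Hy := is_RInt_orbit x t (Rlt_le _ _ (proj1 Ht))).
    rewrite (H0 t (proj1 Ht)) in Hy; exact Hy.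
  - apply (is_RInt_const (V := XR)). }
apply (norm_RInt_le_const (V := XR) _ _ _ _ eps) in Hdiff; [|lra|].
- unfold minus in Hdiff.
  rewrite plus_zero_l, (norm_opp (V := XR)), Rminus_0_r in Hdiff.
  apply (Rmult_le_reg_l t); [lra|].
  rewrite Rplus_0_l.
  eapply Rle_trans; [|exact Hdiff].
  apply (norm_le_scal (V := XR)); lra.
- intros s Hs; left; apply Hnear; lra.
Qed.

Lemma norm_orbit_integral_cesaro (x : X) (t : R) :
  0 < t -> norm (orbit_integral x t) <= t * norm (cesaro T t x).
Proof.
intros Ht.
apply (Rmult_le_reg_l (/ t)); [now apply Rinv_0_lt_compat|].
rewrite <- Rmult_assoc, Rinv_l, Rmult_1_l by lra.
apply (norm_le_scal (V := XR) (/ t)); now apply Rinv_0_lt_compat.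
Qed.

Lemma cesaro_integrable_zero (phi : R -> R) (x : X) :
  (forall t, 1 <= t -> 0 < phi t) ->
  (forall s t, 1 <= s -> s <= t -> phi s <= phi t) ->
  integral_infinite (fun t => 1 / (t * phi t)) 1 ->
  integral_finite (fun t => norm (cesaro T t x) / phi t) 1 ->
  x = zero.
Proof.
intros Hpos Hincr Hinf Hfin.
apply orbit_integral_zero; intros s Hs.
apply (norm_eq_zero (orbit_integral x s)), Rle_antisym; [|apply norm_ge_0].
assert (Hweight : forall t, 1 <= t ->
  norm (orbit_integral x t) * (1 / (t * phi t)) <=
    norm (cesaro T t x) / phi t).
{ intros t Ht; specialize (Hpos t Ht).
  replace (norm (cesaro T t x) / phi t)
    with (t * norm (cesaro T t x) * (1 / (t * phi t))) by (field; lra).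
  apply Rmult_le_compat_r.
  - left; apply Rdiv_lt_0_compat; [lra | apply Rmult_lt_0_compat; lra].
  - apply norm_orbit_integral_cesaro; lra. }
(* Here [w t = 1 / (t phi t)], [g] is the integrand in [Hfin] and [c] is the norm of [y s]. *)
apply (shifted_bound_nonpos _ _ _ (Rabs M) s Hinf Hfin).
- apply Rabs_pos.
- exact Hs.
- intros t Ht; apply Rmult_le_pos; [apply norm_ge_0|].
  left; apply Rinv_0_lt_compat, Hpos, Ht.
- intros t Ht.
  (* Monotonicity of the weight turns [w (t + s)] into [w t] in the term with [y t]. *)
  assert (Hw : 0 < 1 / ((t + s) * phi (t + s)) <= 1 / (t * phi t)).
  { generalize (Hpos t Ht) (Hpos (t + s) ltac:(lra))
      (Hincr t (t + s) Ht ltac:(lra)); intros H1 H2 H3.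
    split.
    - apply Rdiv_lt_0_compat; [lra | apply Rmult_lt_0_compat; lra].
    - apply Rmult_le_compat_l; [lra|].
      apply Rinv_le_contravar; [apply Rmult_lt_0_compat; lra|].
      apply Rmult_le_compat; lra. }
  eapply Rle_trans.
  + apply Rmult_le_compat_r; [lra|].
    apply (norm_orbit_integral_le x s t); lra.
  + rewrite Rmult_plus_distr_r.
    apply Rplus_le_compat; [apply Hweight; lra|].
    rewrite Rmult_assoc; apply Rmult_le_compat_l; [apply Rabs_pos|].
    eapply Rle_trans; [|apply Hweight, Ht].
    apply Rmult_le_compat_l; [apply norm_ge_0 | lra].
Qed.

End Orbits.

(** * The logarithmic weight *)

Lemma ln_1_plus_pos (t : R) : 0 < t -> 0 < ln (1 + t).
Proof. intros Ht; rewrite <- ln_1; apply ln_increasing; lra. Qed.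

(** The integrand dominates [1 / ((1 + t) ln (1 + t))], the derivative of [ln (ln (1 + t))], which
    is unbounded. *)
Lemma integral_infinite_log :
  integral_infinite (fun t => 1 / (t * ln (1 + t))) 1.
Proof.
intros P [C HP].
(* The double exponential inverts [ln (ln b)], so that the minorant integrates to more than [C] over
   [[1, b]]. *)
apply (Filter_prod _ _ _ (fun a => a = 1)
  (fun b => Rmax 1 (exp (exp (C + ln (ln (1 + 1))))) < b)).
- reflexivity.
- now eexists; intros b Hb; exact Hb.
- intros a b -> Hb; simpl.
  assert (H1b : 1 < b) by (eapply Rle_lt_trans; [apply Rmax_l | exact Hb]).
  assert (Hexp : exp (exp (C + ln (ln (1 + 1)))) < b)
    by (eapply Rle_lt_trans; [apply Rmax_r | exact Hb]).
  assert (Hex : ex_RInt (fun t => 1 / (t * ln (1 + t))) 1 b).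
  { apply (ex_RInt_continuous (V := R_CompleteNormedModule)).
    rewrite Rmin_left, Rmax_right by lra.
    intros t Ht; apply (ex_derive_continuous (V := R_NormedModule)).
    assert (0 < t * ln (1 + t))
      by (apply Rmult_lt_0_compat; [lra | apply ln_1_plus_pos; lra]).
    auto_derive; repeat split; lra. }
  exists (RInt (fun t => 1 / (t * ln (1 + t))) 1 b).
  apply (RInt_correct (V := R_CompleteNormedModule)) in Hex.
  split; [exact Hex|]; apply HP.
  assert (Hlog : is_RInt (fun t => 1 / ((1 + t) * ln (1 + t))) 1 b
    (ln (ln (1 + b)) - ln (ln (1 + 1)))).
  { apply (is_RInt_derive (V := R_CompleteNormedModule)
      (fun t => ln (ln (1 + t)))).
    - rewrite Rmin_left, Rmax_right by lra.
      intros t Ht; generalize (ln_1_plus_pos t ltac:(lra)); intros Hln.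
      auto_derive; [repeat split; lra | field; lra].
    - rewrite Rmin_left, Rmax_right by lra.
      intros t Ht; apply (ex_derive_continuous (V := R_NormedModule)).
      assert (0 < (1 + t) * ln (1 + t))
        by (apply Rmult_lt_0_compat; [lra | apply ln_1_plus_pos; lra]).
      auto_derive; repeat split; lra. }
  apply Rlt_le_trans with (ln (ln (1 + b)) - ln (ln (1 + 1))).
  + assert (C + ln (ln (1 + 1)) < ln (ln (1 + b))); [|lra].
    rewrite <- (ln_exp (C + _)).
    apply ln_increasing; [apply exp_pos|].
    rewrite <- (ln_exp (exp _)).
    apply ln_increasing; [apply exp_pos | lra].
  + refine (is_RInt_le _ _ _ _ _ _ _ Hlog Hex _); [lra|].
    intros t Ht; generalize (ln_1_plus_pos t ltac:(lra)); intros Hln.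
    apply Rmult_le_compat_l; [lra|].
    apply Rinv_le_contravar; [apply Rmult_lt_0_compat; lra|].
    apply Rmult_le_compat_r; lra.
Qed.

Theorem theorem5p2 :
  forall (X : CompleteNormedModule C_AbsRing) (T : R -> X -> X)
    (A : X -> X -> Prop),
    C0_semigroup T ->
    bounded_semigroup T ->
    is_generator T (opp_operator A) ->
    (forall phi : R -> R,
       (forall t, 1 <= t -> 0 < phi t) ->
       (forall s t, 1 <= s -> s <= t -> phi s <= phi t) ->
       integral_infinite (fun t => 1 / (t * phi t)) 1 ->
       forall x : X,
         integral_finite (fun t => norm (cesaro T t x) / phi t) 1 ->
         x = zero) /\
    (forall x : X,
       integral_finite (fun t => norm (cesaro T t x) / ln (1 + t)) 1 ->
       x = zero).
Proof.
intros X T A HT [M HM] _; split.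
- intros phi Hpos Hincr Hinf x.
  exact (cesaro_integrable_zero T HT M HM phi x Hpos Hincr Hinf).
- intros x.
  apply (cesaro_integrable_zero T HT M HM (fun t => ln (1 + t))).
  + intros t Ht; apply ln_1_plus_pos; lra.
  + intros s t Hs Hst; apply ln_le; lra.
  + exact integral_infinite_log.
Qed.
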